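(* Let $K\subset\mathbb{R}^M$ be compact with positive Lebesgue measure, for each $N$ let $\mu_N$ be a probability measure on a finite set $\Sigma_N$, and let $F_N:\mathbb{R}^M\times\Sigma_N\to\mathbb{R}$, $F:\mathbb{R}^M\to\mathbb{R}$ be measurable such that their restrictions to $K$ satisfy: $\sup_N\sup_{K\times\Sigma_N}|F_N|<\infty$, $F$ is bounded on $K$, for every $\varepsilon>0$ $\mu_N(\{s:\sup_{\mathbf{p}\in K}|F_N(\mathbf{p},s)-F(\mathbf{p})|>\varepsilon\})\to0$, and $\lim_N\frac1N\log\int_Ke^{NF}=\sup_KF$. Assume moreover: (a) there is $C_1<\infty$ with $\sup_N\sup_{\mathbb{R}^M\times\Sigma_N}F_N<C_1$; (b) there is $C_2<\infty$ with $\int_{\mathbb{R}^M}e^{F_N(\mathbf{p},s)}d\mathbf{p}<C_2$ for all $N$ and $s\in\Sigma_N$; (c) there is $\delta>0$ with $F_N(\mathbf{p},s)-\sup_KF<-\delta$ for all $N$ and all $(\mathbf{p},s)\in K^c\times\Sigma_N$. Then $$\lim_{N\to\infty}\frac1N\,\mathbb{E}_{\mu_N}\Big[\log\int_{\mathbb{R}^M}e^{NF_N(\mathbf{p},s)}d\mathbf{p}\Big]=\sup_KF.$$ *)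

(* Defs.v *)
From HB Require Import structures.
From mathcomp Require Import all_boot all_order all_algebra.
From mathcomp Require Import all_classical all_reals all_analysis.

Set Implicit Arguments.
Unset Strict Implicit.
Unset Printing Implicit Defensive.

Import Order.TTheory GRing.Theory Num.Theory.
Import numFieldNormedType.Exports.

Local Open Scope classical_set_scope.
Local Open Scope ring_scope.

Section prod_sigma_finite.
Local Open Scope ereal_scope.
Context d1 d2 (T1 : measurableType d1) (T2 : measurableType d2) (R : realType).
Variable m1 : {sigma_finite_measure set T1 -> \bar R}.
Variable m2 : {sigma_finite_measure set T2 -> \bar R}.

Definition prodm := (m1 \x m2)%E.

HB.instance Definition _ := Measure.on prodm.

Lemma prodm_sigma_finite : sigma_finite setT prodm.
Proof.
have /sigma_finiteP[F [TF ndF Foo]] := sigma_finiteT m1.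
have /sigma_finiteP[G [TG ndG Goo]] := sigma_finiteT m2.
exists (fun n => F n `*` G n).
  rewrite -setXTT TF TG predeqE => -[x y]; split.
    move=> [/= [n _ Fnx] [k _ Gky]]; exists (maxn n k) => //; split.
    - by move: x Fnx; exact/subsetPset/ndF/leq_maxl.
    - by move: y Gky; exact/subsetPset/ndG/leq_maxr.
  by move=> [n _ []/= ? ?]; split; exists n.
move=> k; have [? ?] := Foo k; have [? ?] := Goo k.
split; first exact: measurableX.
by rewrite /prodm product_measure1E// lte_mul_pinfty// ge0_fin_numE.
Qed.

HB.instance Definition _ := Measure_isSigmaFinite.Build _ _ _ prodm
  prodm_sigma_finite.

End prod_sigma_finite.

(* Lebesgue measure on R^M, restricted to the Borel sets of R^M.             *)
(* R^M is realised as the nested product R * (R * ( ... * unit)) carrying    *)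
(* the product (= Borel) sigma-algebra and the iterated product measure      *)
(* lambda \x (lambda \x ( ... \x dirac tt)), lambda = Lebesgue measure on R. *)
(* [vec_of] is the canonical bijection of this nested product onto the       *)
(* row-vector space 'rV[R]_M (which carries the usual topology/norm of R^M). *)

Record RnSpace (R : realType) := MkRnSpace {
  rn_disp : measure_display;
  rn_type : measurableType rn_disp;
  rn_meas : {sigma_finite_measure set rn_type -> \bar R} }.

Definition lebR (R : realType) : {sigma_finite_measure set _ -> \bar R} :=
  @lebesgue_measure R.

Fixpoint Rn (R : realType) (M : nat) : RnSpace R :=
  match M with
  | 0 => @MkRnSpace R _ unit (@dirac _ unit tt R)
  | m.+1 => @MkRnSpace R _ _ (prodm (lebR R) (rn_meas (Rn R m)))
  end.

Definition RM (R : realType) (M : nat) := rn_type (Rn R M).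
Definition lebesgueM (R : realType) (M : nat) := rn_meas (Rn R M).

(* Coordinates: (x, y) |-> the row vector (x, y_0, ..., y_{m-1}). *)
Fixpoint vec_of (R : realType) (M : nat) : RM R M -> 'rV[R]_M :=
  match M return RM R M -> 'rV[R]_M with
  | 0 => fun _ => 0
  | m.+1 => fun x =>
      \row_(i < m.+1)
        (match unlift ord0 i with
         | None => x.1
         | Some j => vec_of x.2 ord0 j
         end)
  end.

Definition intRM (R : realType) (M : nat) (A : set 'rV[R]_M)
    (f : 'rV[R]_M -> \bar R) : \bar R :=
  (\int[lebesgueM R M]_(x in vec_of (M:=M) @^-1` A) f (vec_of x))%E.

Definition lebM (R : realType) (M : nat) (A : set 'rV[R]_M) : \bar R :=
  lebesgueM R M (vec_of (M:=M) @^-1` A).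

Definition measurableRM (R : realType) (M : nat) (f : 'rV[R]_M -> R) : Prop :=
  measurable_fun setT (f \o vec_of (M:=M)).

(* Main.v *)
Require Import Defs.
From HB Require Import structures.
From mathcomp Require Import all_boot all_order all_algebra.
From mathcomp Require Import all_classical all_reals all_analysis.
From mathcomp Require Import measurable_realfun lra finmap.

Import Order.TTheory GRing.Theory Num.Theory.
Import numFieldNormedType.Exports.

Local Open Scope classical_set_scope.
Local Open Scope ring_scope.

(* Write Z_N(s) = int e^{N F_N(p,s)} dp and fe_N(s) = N^-1 ln Z_N(s), and let
   S = sup_K F.  The theorem says that the mu_N-average of fe_N tends to S.

   The argument is carried out for an arbitrary measure space T, a measurable
   K with 0 < lambda(K), and functions f_N(., s), g on T (section free_energy):
   - every fe_N(s) is bounded uniformly in N and s, from below by restricting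
     the integral to K and from above by e^{N f_N} <= e^{(N-1) C1} e^{f_N};
   - if f_N(., s) is eps-close to g on K (a "good" configuration), then
     fe_N(s) >= N^-1 ln int_K e^{N g} - eps, and since f_N <= S + eps
     everywhere (by hypothesis (c) outside K), fe_N(s) <= S + eps + O(1/N);
   - hence good configurations have fe_N(s) close to S for large N, and the
     average converges since bad configurations carry vanishing weight and
     bounded values (section averages). *)

Lemma box_measurable (R : realType) (m : nat) (P : 'I_m -> set R) :
  (forall j, measurable (P j)) ->
  measurable (@vec_of R m @^-1` [set y | forall j, P j (y ord0 j)]).
Proof.
elim: m P => [|m IH] P mP.
  rewrite [X in measurable X](_ : _ = setT); first exact: measurableT.
  by apply/seteqP; split => // x _ [].
rewrite [X in measurable X](_ : _ = P ord0 `*`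
    (@vec_of R m @^-1` [set y | forall j, P (lift ord0 j) (y ord0 j)])).
  by apply: measurableX; [exact: mP | exact: (IH (fun j => P (lift ord0 j)))].
apply/seteqP; split => [[a b] /= Pab|[a b] /= [Pa Pb] j].
  split; first by have := Pab ord0; rewrite mxE unlift_none.
  by move=> j; have := Pab (lift ord0 j); rewrite mxE liftK.
by rewrite mxE; case: unliftP => [k ->|->].
Qed.

Lemma closed_ball_measurable (R : realType) (c r : R) :
  measurable [set x : R | `|c - x| <= r].
Proof.
rewrite [X in measurable X](_ : _ = [set` `[c - r, c + r]]).
  exact: measurable_itv.
by apply/seteqP; split => x /=; rewrite in_itv /= ler_norml; lra.
Qed.

Lemma invSn_lt {R : realType} (e : R) : 0 < e -> exists n : nat, n.+1%:R^-1 < e.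
Proof.
move=> e0; exists (Num.truncn e^-1).
by rewrite invf_plt ?posrE ?invr_gt0 // truncnS_gt.
Qed.

(* A compact subset of R^M is measurable: it is the intersection over n of
   finite unions of closed coordinate boxes of radius 1/(n+1) covering it. *)
Lemma compact_preimage_measurable {R : realType} {M : nat} {K : set 'rV[R]_M} :
  compact K -> measurable (@vec_of R M @^-1` K).
Proof.
move=> cK; have clK : closed K by apply: compact_closed => //; exact: norm_hausdorff.
pose box (x : 'rV[R]_M) (r : R) :=
  [set y : 'rV[R]_M | forall j, `|x ord0 j - y ord0 j| <= r].
have fin_cover n : exists D : {fset 'rV[R]_M},
    {subset D <= K} /\ K `<=` \bigcup_(x in [set` D]) box x n.+1%:R^-1.
  have := cK; rewrite compact_cover => /(_ _ K (fun x => ball x n.+1%:R^-1)).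
  case=> [x _|x Kx|D DK cover]; [exact: ball_open | by exists x => //; exact: ballxx|].
  exists D; split => // y /cover [x Dx [_ /(_ ord0) bxy]].
  by exists x => // j; exact/ltW/bxy.
have [D D_cover] := choice fin_cover.
rewrite [X in measurable X](_ : _ =
    \bigcap_n \bigcup_(x in [set` D n]) (@vec_of R M @^-1` box x n.+1%:R^-1)).
  apply: bigcap_measurable => [|n _]; first by exists 0%N.
  apply: fin_bigcup_measurable => [|x _]; first exact: finite_fset.
  have := @box_measurable R M (fun j => [set a | `|x ord0 j - a| <= n.+1%:R^-1]).
  by apply => j; exact: closed_ball_measurable.
apply/seteqP; split => p /= Kp; first by move=> n _; have [_ /(_ _ Kp)] := D_cover n.
apply: clK => U /nbhs_ballP [e e0 eU].
have [n ne] := @invSn_lt _ e e0; have [x Dx xp] := Kp n I.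
exists x; split; first by have [/(_ _ Dx)] := D_cover n; rewrite in_setE.
apply: eU; split => // i j; rewrite (ord1 i) /ball /= distrC.
exact: le_lt_trans (xp j) ne.
Qed.

Section exponential_integrals.
Context {R : realType} {d : measure_display} {T : measurableType d}.
Variable mu : {measure set T -> \bar R}.

Lemma measurable_expM {D : set T} {f : T -> R} (k : R) :
  measurable_fun D f -> measurable_fun D (fun x => (expR (k * f x))%:E).
Proof.
by move=> mf; apply/measurable_EFinP; apply: measurableT_comp => //; exact: measurable_funM.
Qed.

Lemma integral_expS_le {f : T -> R} {c : R} (n : nat) :
  measurable_fun setT f -> (forall x, f x <= c) ->
  (\int[mu]_x (expR (n.+1%:R * f x))%:E <=
     (expR (n%:R * c))%:E * \int[mu]_x (expR (f x))%:E)%E.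
Proof.
move=> mf fc; have mef : measurable_fun setT (fun x => (expR (f x))%:E).
  by apply/measurable_EFinP; exact: measurableT_comp.
rewrite -ge0_integralZl_EFin //; apply: ge0_le_integral => //.
- exact: measurable_expM.
- by apply/measurable_EFinP; apply: measurable_funM => //; exact/measurable_EFinP.
move=> x _; rewrite /= lee_fin -expRD ler_expR -natr1 mulrDl mul1r lerD2r.
exact: ler_wpM2l.
Qed.

Lemma integral_exp_ge {D : set T} {f : T -> R} {b k : R} :
  measurable D -> measurable_fun D f -> 0 <= k -> (forall x, D x -> b <= f x) ->
  ((expR (k * b))%:E * mu D <= \int[mu]_(x in D) (expR (k * f x))%:E)%E.
Proof.
move=> mD mf k0 fb; rewrite -integral_cst //; apply: ge0_le_integral => //.
- by move=> x _; rewrite lee_fin expR_ge0.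
- exact: measurable_expM.
by move=> x Dx; rewrite /= lee_fin ler_expR ler_wpM2l // fb.
Qed.

Lemma integral_exp_shift {D : set T} {f g : T -> R} {k e : R} :
  measurable D -> measurable_fun D f -> measurable_fun D g -> 0 <= k ->
  (forall x, D x -> f x <= g x + e) ->
  (\int[mu]_(x in D) (expR (k * f x))%:E <=
     (expR (k * e))%:E * \int[mu]_(x in D) (expR (k * g x))%:E)%E.
Proof.
move=> mD mf mg k0 fg; rewrite -ge0_integralZl_EFin //; last exact: measurable_expM.
apply: ge0_le_integral => //; first exact: measurable_expM.
  by apply/measurable_EFinP; apply: measurable_funM => //; exact/measurable_EFinP/measurable_expM.
move=> x Dx; rewrite /= lee_fin -expRD ler_expR -mulrDr addrC.
exact/ler_wpM2l/fg.
Qed.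

End exponential_integrals.

Section normalized_log.
Context {R : realType}.

Lemma ln_le_expM (r a b : R) : 0 < r -> 0 < b -> r <= expR a * b -> ln r <= a + ln b.
Proof.
move=> r0 b0 rab; rewrite -[a in a + _]expRK -lnM ?posrE ?expR_gt0 //.
by rewrite ler_ln // posrE mulr_gt0 ?expR_gt0.
Qed.

Lemma ln_ge_expM (r a b : R) : 0 < b -> expR a * b <= r -> a + ln b <= ln r.
Proof.
move=> b0 abr; have ab0 : 0 < expR a * b by rewrite mulr_gt0 ?expR_gt0.
rewrite -[a in a + _]expRK -lnM ?posrE ?expR_gt0 //.
by rewrite ler_ln // posrE (lt_le_trans ab0).
Qed.

Lemma normalize_ln (N : nat) (a c : R) : (0 < N)%N ->
  N%:R^-1 * (N%:R * a + c) = a + N%:R^-1 * c.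
Proof. by move=> N0; rewrite mulrDr mulrA mulVf ?mul1r // pnatr_eq0 -lt0n. Qed.

Lemma normlog_le (N : nat) (x : \bar R) (a b : R) : (0 < N)%N -> 0 < b ->
  (0 < x)%E -> (x <= (expR (N%:R * a) * b)%:E)%E ->
  N%:R^-1 * ln (fine x) <= a + N%:R^-1 * ln b.
Proof.
move=> N0 b0; case: x => // r; rewrite lte_fin lee_fin /= => r0 rab.
rewrite -normalize_ln //; apply: ler_wpM2l; first by rewrite invr_ge0.
exact: ln_le_expM.
Qed.

Lemma normlog_ge (N : nat) (x : \bar R) (a b : R) : (0 < N)%N -> 0 < b ->
  ((expR (N%:R * a) * b)%:E <= x)%E -> (x < +oo)%E ->
  a + N%:R^-1 * ln b <= N%:R^-1 * ln (fine x).
Proof.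
move=> N0 b0; case: x => // r; rewrite lee_fin /= => abr _.
rewrite -normalize_ln //; apply: ler_wpM2l; first by rewrite invr_ge0.
exact: ln_ge_expM.
Qed.

Lemma norm_le_between {lo x hi : R} : lo <= x -> x <= hi -> `|x| <= `|lo| + `|hi|.
Proof.
move=> lox xhi; have := ler_norm hi; have := ler_norm (- lo).
rewrite normrN ler_norml; have := normr_ge0 lo; have := normr_ge0 hi; lra.
Qed.

End normalized_log.

Section averages.
Context {R : realType}.

Lemma avg_dist_le {T : finType} {w a : T -> R} {P : pred T} {S A m : R} :
  (forall s, 0 <= w s) -> \sum_s w s = 1 -> 0 <= m ->
  (forall s, `|a s| <= A) -> (forall s, ~~ P s -> `|S - a s| <= m) ->
  `|S - \sum_s w s * a s| <= m + (\sum_(s | P s) w s) * (A + `|S|).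
Proof.
move=> w0 w1 m0 aA good.
have -> : S - \sum_s w s * a s = \sum_s w s * (S - a s).
  rewrite -[X in X - _]mulr1 -w1 mulr_sumr -sumrB.
  by apply: eq_bigr => s _; rewrite mulrBr mulrC.
apply: le_trans (ler_norm_sum _ _ _) _.
rewrite (bigID P) /= addrC lerD //.
  apply: le_trans (_ : \sum_(s | ~~ P s) w s * m <= m).
    apply: ler_sum => s Ps; rewrite normrM ger0_norm //.
    exact/ler_wpM2l/good.
  rewrite -mulr_suml -[X in _ <= X]mul1r ler_wpM2r // -w1.
  by rewrite [X in _ <= X](bigID (fun s => ~~ P s)) /= lerDl sumr_ge0.
rewrite mulr_suml; apply: ler_sum => s Ps; rewrite normrM ger0_norm //.
apply: ler_wpM2l => //; apply: le_trans (ler_normB _ _) _.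
by rewrite addrC lerD2r.
Qed.

Lemma avg_cvg {Sigma : nat -> finType} {w a : forall N, Sigma N -> R}
    {bad : R -> forall N, pred (Sigma N)} {S A : R} :
  (\forall N \near \oo, [/\ forall s, 0 <= w N s, \sum_s w N s = 1
                          & forall s, `|a N s| <= A]) ->
  (forall eps, 0 < eps -> (fun N => \sum_(s | bad eps N s) w N s) @ \oo --> 0) ->
  (forall e, 0 < e -> exists2 eps, 0 < eps &
     \forall N \near \oo, forall s, ~~ bad eps N s -> `|S - a N s| <= e) ->
  (fun N => \sum_s w N s * a N s) @ \oo --> S.
Proof.
move=> wa bad0 good; apply/cvgrPdist_le => e e0.
have e20 : 0 < e / 2 by rewrite divr_gt0.
have [eps eps0 goodN] := good _ e20.
have D0 : 0 < `|A| + `|S| + 1 by rewrite ltr_wpDl // addr_ge0.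
move/cvgrPdist_le: (bad0 _ eps0) => /(_ _ (divr_gt0 e20 D0)) smallN.
apply: filterS (filterI wa (filterI goodN smallN)) => N [[w0 w1 aA] [gN]].
rewrite /= sub0r normrN => small.
have mass0 : 0 <= \sum_(s | bad eps N s) w N s by exact: sumr_ge0.
apply: le_trans (avg_dist_le w0 w1 (ltW e20) aA gN) _.
have : (\sum_(s | bad eps N s) w N s) * (A + `|S|) <= e / 2.
  rewrite ger0_norm // ler_pdivlMr // in small; apply: le_trans small.
  by apply: ler_wpM2l => //; have := ler_norm A; lra.
lra.
Qed.

End averages.

Section free_energy.
Context {R : realType} {d : measure_display} {T : measurableType d}.
Variable lam : {measure set T -> \bar R}.
Variables (K : set T) (Sigma : nat -> finType).
Variables (f : forall N, T -> Sigma N -> R) (g : T -> R).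
Variables (S bf bg C1 C2 : R).
Hypothesis mK : measurable K.
Hypothesis lamK_gt0 : (0 < lam K)%E.
Hypothesis mf : forall N, (0 < N)%N -> forall s, measurable_fun setT (f N ^~ s).
Hypothesis mg : measurable_fun setT g.
Hypothesis f_geK : forall N, (0 < N)%N -> forall s x, K x -> bf <= f N x s.
Hypothesis g_geK : forall x, K x -> bg <= g x.
Hypothesis g_leK : forall x, K x -> g x <= S.
Hypothesis f_le_C1 : forall N, (0 < N)%N -> forall s x, f N x s <= C1.
Hypothesis f_int_lt_C2 : forall N, (0 < N)%N -> forall s,
  (\int[lam]_x (expR (f N x s))%:E < C2%:E)%E.
Hypothesis f_le_S_offK : forall N, (0 < N)%N -> forall s x, ~ K x -> f N x s <= S.

Definition Z N (s : Sigma N) := (\int[lam]_x (expR (N%:R * f N x s))%:E)%E.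
Definition ZK N := (\int[lam]_(x in K) (expR (N%:R * g x))%:E)%E.
Definition fe N (s : Sigma N) := N%:R^-1 * ln (fine (Z N s)).
Definition feK N := N%:R^-1 * ln (fine (ZK N)).

Lemma ZK_gt0 N : (0 < ZK N)%E.
Proof.
apply: (@lt_le_trans _ _ ((expR (N%:R * bg))%:E * lam K)%E).
  by rewrite mule_gt0 ?lte_fin ?expR_gt0.
exact: (integral_exp_ge lam mK (measurable_funS measurableT (subsetT K) mg) (ler0n _ N) g_geK).
Qed.

Section one_configuration.
Variables (N : nat) (s : Sigma N).
Hypothesis N0 : (0 < N)%N.

Lemma C2_gt0 : 0 < C2.
Proof.
rewrite -lte_fin; apply: le_lt_trans (f_int_lt_C2 _ N0 s).
by apply: integral_ge0 => x _; rewrite lee_fin expR_ge0.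
Qed.

(* Upper bound: e^{N f} <= e^{(N-1) c} e^f when f <= c. *)
Lemma Z_le {c : R} : (forall x, f N x s <= c) ->
  (Z N s <= (expR (N.-1%:R * c) * C2)%:E)%E.
Proof.
move=> fc; have := integral_expS_le lam N.-1 (mf _ N0 s) fc; rewrite prednK // => ZE.
apply: le_trans ZE _; rewrite EFinM lee_wpmul2l ?lee_fin ?expR_ge0 //.
exact/ltW/f_int_lt_C2.
Qed.

(* Lower bound: restrict the integral to K, where f >= bf. *)
Lemma Z_ge : ((expR (N%:R * bf))%:E * lam K <= Z N s)%E.
Proof.
apply: le_trans (integral_exp_ge lam mK (measurable_funS measurableT (subsetT K) (mf _ N0 s))
  (ler0n _ N) (f_geK _ N0 s)) _.
by apply: ge0_subset_integral => //; exact: measurable_expM (mf _ N0 s).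
Qed.

Lemma Z_gt0 : (0 < Z N s)%E.
Proof. by apply: lt_le_trans Z_ge; rewrite mule_gt0 ?lte_fin ?expR_gt0. Qed.

Lemma Z_fin : Z N s \is a fin_num.
Proof. by rewrite ge0_fin_numE ?(ltW Z_gt0) // (le_lt_trans (Z_le (f_le_C1 _ N0 s))) ?ltry. Qed.

(* K has finite measure, since e^{N bf} lam K <= Z_N(s) < +oo. *)
Lemma lamK_fin : lam K \is a fin_num.
Proof.
rewrite ge0_fin_numE ?ltW //; move: (le_trans Z_ge (Z_le (f_le_C1 _ N0 s))).
case: (lam K) lamK_gt0 => [r _ _| _|] //=; first exact: ltry.
by rewrite mulry gtr0_sg ?expR_gt0 // mul1e leNgt ltry.
Qed.

Lemma fe_le {c : R} : (forall x, f N x s <= c) -> fe N s <= c + N%:R^-1 * (ln C2 - c).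
Proof.
move=> fc; have C20 := C2_gt0.
have -> : ln C2 - c = ln (expR (- c) * C2) by rewrite lnM ?posrE ?expR_gt0 // expRK addrC.
apply: normlog_le => //.
- by rewrite mulr_gt0 ?expR_gt0.
- exact: Z_gt0.
rewrite mulrA -expRD; apply: le_trans (Z_le fc) _.
by rewrite -[in N%:R](prednK N0) -natr1 mulrDl mul1r addrK.
Qed.

Lemma fe_ge : bf + N%:R^-1 * ln (fine (lam K)) <= fe N s.
Proof.
apply: normlog_ge => //; last by rewrite ltey_eq Z_fin.
  by rewrite fine_gt0 // lamK_gt0 ltey_eq lamK_fin.
by rewrite EFinM fineK ?lamK_fin //; exact: Z_ge.
Qed.

Lemma fe_bounded : `|fe N s| <= `|bf| + `|ln (fine (lam K))| + `|C1| + `|ln C2 - C1|.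
Proof.
have Ninv (x : R) : `|N%:R^-1 * x| <= `|x|.
  rewrite normrM ger0_norm ?invr_ge0 // ler_piMl //.
  by rewrite invf_le1 ?ler1n ?ltr0n.
apply: le_trans (norm_le_between fe_ge (fe_le (f_le_C1 _ N0 s))) _.
rewrite -[X in _ <= X]addrA lerD //.
all: by apply: le_trans (ler_normD _ _) _; rewrite lerD2l.
Qed.

Lemma ZK_le_Z (eps : R) : (forall x, K x -> `|f N x s - g x| <= eps) ->
  (ZK N <= (expR (N%:R * eps))%:E * Z N s)%E.
Proof.
move=> close; have g_le_f x : K x -> g x <= f N x s + eps.
  by move=> Kx; have := close x Kx; rewrite distrC ler_norml => /andP[_ ?]; lra.
apply: le_trans (integral_exp_shift lam mK (measurable_funS measurableT (subsetT K) mg)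
  (measurable_funS measurableT (subsetT K) (mf _ N0 s)) (ler0n R N) g_le_f) _.
rewrite lee_wpmul2l ?lee_fin ?expR_ge0 //.
by apply: ge0_subset_integral => //; exact: measurable_expM (mf _ N0 s).
Qed.

Lemma fe_good (eps : R) : 0 <= eps -> (forall x, K x -> `|f N x s - g x| <= eps) ->
  feK N - eps <= fe N s <= S + eps + N%:R^-1 * (ln C2 - (S + eps)).
Proof.
move=> eps0 close; apply/andP; split.
  rewrite lerBlDl /feK /fe; apply: normlog_le => //.
  - by rewrite fine_gt0 // Z_gt0 ltey_eq Z_fin.
  - exact: ZK_gt0.
  - by rewrite EFinM fineK ?Z_fin //; exact: ZK_le_Z.
apply: fe_le => x; have [Kx|nKx] := pselect (K x).
  by have := close x Kx; have := g_leK x Kx; rewrite ler_norml => gS /andP[_]; lra.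
by have := f_le_S_offK _ N0 s x nKx; lra.
Qed.

End one_configuration.

Lemma fe_near_S : feK @ \oo --> S -> forall e, 0 < e ->
  \forall N \near \oo, forall s : Sigma N,
    (forall x, K x -> `|f N x s - g x| <= e / 3) -> `|S - fe N s| <= e.
Proof.
move=> feK_S e e0; have e30 : 0 < e / 3 by rewrite divr_gt0.
set k := ln C2 - (S + e / 3).
move/cvgrPdist_le : feK_S => /(_ _ e30) feK_near.
apply: filterS (filterI feK_near (nbhs_infty_gtr (`|k| / (e / 3)))).
move=> N [/= SfeK Nlarge] s close.
have N0 : (0 < N)%N.
  rewrite -(ltr0n R); apply: le_lt_trans Nlarge.
  exact: divr_ge0 (normr_ge0 _) (ltW e30).
have kN : N%:R^-1 * k <= e / 3.
  rewrite mulrC ler_pdivrMr ?ltr0n // mulrC; apply: le_trans (ler_norm k) _.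
  by move: Nlarge; rewrite ltr_pdivrMr // => /ltW.
have /andP[lo hi] := fe_good N s N0 (e / 3) (ltW e30) close.
move: SfeK hi; rewrite -/k !ler_norml => /andP[? ?] ?; apply/andP; split; lra.
Qed.

Lemma avg_fe_cvg (w : forall N, Sigma N -> R) (bad : R -> forall N, pred (Sigma N)) :
  (forall N, (0 < N)%N -> (forall s, 0 <= w N s) /\ \sum_s w N s = 1) ->
  (forall eps, 0 < eps -> (fun N => \sum_(s | bad eps N s) w N s) @ \oo --> 0) ->
  (forall eps N s, ~~ bad eps N s -> forall x, K x -> `|f N x s - g x| <= eps) ->
  feK @ \oo --> S ->
  (fun N => N%:R^-1 * \sum_s w N s * ln (fine (Z N s))) @ \oo --> S.
Proof.
move=> w_prob bad0 good feK_S.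
have -> : (fun N => N%:R^-1 * \sum_s w N s * ln (fine (Z N s))) =
    (fun N => \sum_s w N s * fe N s).
  by apply/funext => N; rewrite mulr_sumr; apply: eq_bigr => s _; rewrite mulrCA.
apply: avg_cvg bad0 _.
- exists 1%N => // N /= N0; have [w0 w1] := w_prob N N0.
  by split => // s; exact: fe_bounded.
- move=> e e0; exists (e / 3); first by rewrite divr_gt0.
  by apply: filterS (fe_near_S feK_S _ e0) => N close s /good; exact: close.
Qed.

End free_energy.

Lemma le_sup_image {R : realType} {T : Type} {A : set T} {h : T -> R} {b : R} :
  A !=set0 -> (forall x, A x -> `|h x| <= b) -> forall x, A x -> h x <= sup [set h y | y in A].
Proof.
move=> [x0 Ax0] hb x Ax; apply: sup_upper_bound; last by exists x.
split; first by exists (h x0), x0.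
by exists b => _ [y Ay <-]; have := hb y Ay; rewrite ler_norml => /andP[].
Qed.

Theorem mainTheorem13 (R : realType) (M : nat)
  (K : set 'rV[R]_M)
  (Sigma : nat -> finType)
  (mu : forall N : nat, {ffun Sigma N -> R})
  (FN : forall N : nat, 'rV[R]_M -> Sigma N -> R)
  (F : 'rV[R]_M -> R) :
  (* K compact with positive Lebesgue measure *)
  compact K ->
  (0 < lebM K)%E ->
  (* mu_N is a probability measure on the finite set Sigma_N *)
  (forall N : nat, (0 < N)%N ->
     (forall s, 0 <= mu N s) /\ \sum_(s : Sigma N) mu N s = 1) ->
  (* measurability of F_N (on R^M x Sigma_N, Sigma_N discrete) and of F *)
  (forall N : nat, (0 < N)%N -> forall s : Sigma N,
     measurableRM (fun p => FN N p s)) ->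
  measurableRM F ->
  (* sup_N sup_{K x Sigma_N} |F_N| < oo *)
  (exists B : R, forall N : nat, (0 < N)%N -> forall p (s : Sigma N),
     K p -> `|FN N p s| <= B) ->
  (* F bounded on K *)
  (exists B : R, forall p, K p -> `|F p| <= B) ->
  (* mu_N (sup_K |F_N(., s) - F| > eps) -> 0 for every eps > 0 *)
  (forall eps : R, 0 < eps ->
     (fun N : nat => \sum_(s : Sigma N |
          `[< exists2 p, K p & eps < `|FN N p s - F p| >]) mu N s)
       @ \oo --> (0 : R)) ->
  (* (1/N) log int_K e^{N F} -> sup_K F *)
  (fun N : nat =>
     N%:R^-1 * ln (fine (intRM K (fun p => (expR (N%:R * F p))%:E))))
     @ \oo --> sup [set F p | p in K] ->
  (* (a) *)
  (exists C1 : R, forall N : nat, (0 < N)%N -> forall p (s : Sigma N),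
     FN N p s < C1) ->
  (* (b) *)
  (exists C2 : R, forall N : nat, (0 < N)%N -> forall s : Sigma N,
     (intRM setT (fun p => (expR (FN N p s))%:E) < C2%:E)%E) ->
  (* (c) *)
  (exists2 delta : R, 0 < delta &
     forall N : nat, (0 < N)%N -> forall p (s : Sigma N),
       ~ K p -> FN N p s - sup [set F q | q in K] < - delta) ->
  (* conclusion *)
  (fun N : nat =>
     N%:R^-1 * \sum_(s : Sigma N) mu N s *
       ln (fine (intRM setT (fun p => (expR (N%:R * FN N p s))%:E))))
    @ \oo --> sup [set F p | p in K].
Proof.
move=> cK lebK mu_prob mFN mF [B FN_bd] [BF F_bd] bad0 FK_cvg [C1 FN_C1] [C2 FN_C2]
  [del del0 FN_offK].
set S := sup [set F p | p in K].
have K0 : K !=set0.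
  apply/set0P/negP => /eqP K0; move: lebK.
  by rewrite /lebM K0 preimage_set0 measure0 ltxx.
have F_le_S := le_sup_image K0 F_bd.
have FN_ge N (N0 : (0 < N)%N) (s : Sigma N) x : K (vec_of x) -> - B <= FN N (vec_of x) s.
  by move/(FN_bd N N0 _ s); rewrite ler_norml => /andP[].
have F_ge x : K (vec_of x) -> - BF <= F (vec_of x).
  by move/F_bd; rewrite ler_norml => /andP[].
have FN_le_S N (N0 : (0 < N)%N) (s : Sigma N) x : ~ K (vec_of x) -> FN N (vec_of x) s <= S.
  by move/(FN_offK N N0 _ s); rewrite -/S => ?; lra.
have close eps N (s : Sigma N) : ~~ `[< exists2 p, K p & eps < `|FN N p s - F p| >] ->
    forall x, K (vec_of x) -> `|FN N (vec_of x) s - F (vec_of x)| <= eps.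
  by move=> /asboolPn far x Kx; rewrite leNgt; apply/negP => ?; apply: far; exists (vec_of x).
exact: (@avg_fe_cvg _ _ _ (lebesgueM R M) (@vec_of R M @^-1` K) Sigma
  (fun N x s => FN N (vec_of x) s) (F \o @vec_of R M) S (- B) (- BF) C1 C2
  (compact_preimage_measurable cK) lebK mFN mF FN_ge F_ge
  (fun x => F_le_S _) (fun N N0 s x => ltW (FN_C1 N N0 _ s)) FN_C2 FN_le_S
  _ _ mu_prob bad0 close FK_cvg).
Qed.
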